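(* Let $Z(t),t\in\mathcal T$ be a random process with values in $[-\infty,\infty)$ and $\mathbb E\{e^{Z(t)}\}=1$, $t\in\mathcal T$. For any distinct $t_i\in\mathcal T$, $1\le i\le n$, the distribution function $H$ of $(\zeta_Z(t_1),\ldots,\zeta_Z(t_n))$ is given by $$-\ln H(x)=\sum_{k=1}^ne^{-x_k}\Psi_k(x),\qquad \Psi_k(x)=\mathbb P\Bigl\{\inf\operatorname{argmax}_{1\le i\le n}\bigl(\Theta_{t_k}(t_i)-x_i\bigr)=k\Bigr\},$$ for any $x=(x_1,\ldots,x_n)\in\mathbb R^n$.
   Context: $\mathcal T=\mathbb R^d$ or $\mathbb Z^d$, $d\ge1$; $e^{-\infty}=0$. The associated max-stable process is $\zeta_Z(t)=\max_{i\ge1}(P_i+Z_i(t))$, $t\in\mathcal T$, where $\sum_i\varepsilon_{P_i}$ is a Poisson point process on $\mathbb R$ with intensity $e^{-x}dx$ and $Z_i$ are independent copies of $Z$, independent of the point process. For $h\in\mathcal T$ (note $\mathbb P\{Z(h)>-\infty\}>0$), let $V_h$ be a process with the conditional law of $Z$ given $Z(h)>-\infty$, let $V_h^{[h]}$ be its tilt, with law $$\mathbb P\{V_h^{[h]}\in A\}=\mathbb E\bigl\{e^{V_h(h)-\ln\mathbb E\{e^{V_h(h)}\}}\,\mathbb I\{V_h\in A\}\bigr\}$$ for $A$ in the $\sigma$-field generated by the evaluation maps, and set $\Theta_h(t)=V_h^{[h]}(t)-V_h^{[h]}(h)$, $t\in\mathcal T$. $\inf\operatorname{argmax}_{1\le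 i\le n}a_i$ is the smallest index at which $\max_{1\le i\le n}a_i$ is attained. *)

(* Defs.v *)
From HB Require Import structures.
From mathcomp Require Export all_boot all_order all_algebra finmap.
From mathcomp Require Export all_classical all_reals all_analysis.
From mathcomp Require Export measurable_realfun.

Set Implicit Arguments.
Unset Strict Implicit.
Unset Printing Implicit Defensive.

Import Order.TTheory GRing.Theory Num.Theory.
Import numFieldNormedType.Exports.

Local Open Scope classical_set_scope.
Local Open Scope ring_scope.
Local Open Scope ereal_scope.

Inductive index_kind := Euclidean | Lattice.

Definition index_set (R : realType) (K : index_kind) (d : nat) : Type :=
  match K with Euclidean => 'rV[R]_d | Lattice => 'rV[int]_d end.

(* No joint regularity is assumed: only the evaluations are random variables. *)
Record process (R : realType) (dO : measure_display) (Om : measurableType dO)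
    (T : Type) := Process {
  path :> T -> Om -> \bar R ;
  path_measurable : forall t, measurable_fun [set: Om] (path t) ;
  path_lty : forall t w, path t w < +oo }.

Definition sigma_gen (S I : Type) (dE : measure_display)
    (E : measurableType dE) (X : I -> S -> E) : set_system S :=
  <<s [set A | exists i, exists2 B, measurable B & A = X i @^-1` B] >>.

Definition eval_sigma (R : realType) (T : Type) : set_system (T -> \bar R) :=
  sigma_gen (fun (t : T) (f : T -> \bar R) => f t).

Definition law (R : realType) (dO : measure_display) (Om : measurableType dO)
    (Pr : probability Om R) (T : Type) (Z : process R Om T)
    (A : set (T -> \bar R)) : \bar R :=
  Pr [set w | A (fun t => Z t w)].

Section Laws.
Variables (R : realType) (T : Type) (d1 d2 : measure_display).
Variables (O1 : measurableType d1) (P1 : probability O1 R).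
Variables (O2 : measurableType d2) (P2 : probability O2 R).

Definition same_law (Y : process R O2 T) (Z : process R O1 T) : Prop :=
  forall A, eval_sigma A -> law P2 Y A = law P1 Z A.

Definition has_conditional_law (h : T) (V : process R O2 T)
    (Z : process R O1 T) : Prop :=
  forall A, eval_sigma A ->
    law P2 V A = law P1 Z (A `&` [set f | -oo < f h])
                 / law P1 Z [set f | -oo < f h].

(* V is meant to be Z conditioned on Z(h) > -oo, and h the tilting point. *)
Definition has_tilted_law (h : T) (W : process R O2 T)
    (V : process R O1 T) : Prop :=
  forall A, eval_sigma A ->
    law P2 W A =
      \int[P1]_w (expeR (V h w - lne (\int[P1]_v expeR (V h v)))
                  * (\1_[set v | A (fun t => V t v)] w)%:E).

End Laws.

(* W(h) = -oo has probability zero when W is tilted at h, so the value of the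
   difference there (where -oo - -oo = -oo) plays no role. *)
Definition Theta (R : realType) (dO : measure_display) (Om : measurableType dO)
    (T : Type) (W : process R Om T) (h t : T) (w : Om) : \bar R :=
  W t w - W h w.

Section Independence.
Variables (R : realType) (dO : measure_display) (Om : measurableType dO).
Variable Pr : probability Om R.

Definition independent2 (F G : set_system Om) : Prop :=
  forall A B, F A -> G B -> Pr (A `&` B) = Pr A * Pr B.

Definition independent_family (I : choiceType) (F : I -> set_system Om) : Prop :=
  forall (J : {fset I}) (A : I -> set Om),
    (forall j, j \in J -> F j (A j)) ->
    Pr (\bigcap_(j in [set` J]) A j) = \prod_(j <- J) Pr (A j).

End Independence.

Section Poisson.
Variables (R : realType) (dO : measure_display) (Om : measurableType dO).
Variable Pr : probability Om R.

Definition point_count (P : nat -> Om -> R) (B : set R) (w : Om) : \bar R :=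
  counting [set i | B (P i w)].

(* The second argument of the library's poisson_prob is a dummy. Its mass
   function poisson_pmf is not used because it is constantly 1 at rate 0.
   The law of the count on sets of infinite measure is determined by the rest
   when mu is sigma-finite. *)
Record is_poisson_process (mu : set R -> \bar R) (P : nat -> Om -> R) : Prop := {
  poisson_count : forall B, measurable B -> mu B < +oo -> forall k : nat,
    Pr [set w | point_count P B w = k%:R%:E]
      = poisson_prob (fine (mu B)) k [set k] ;
  poisson_indep : forall B : nat -> set R,
    (forall j, measurable (B j)) -> trivIset [set: nat] B ->
    independent_family Pr
      (fun j => sigma_gen (fun _ : unit => point_count P (B j))) }.

End Poisson.

Definition exp_intensity (R : realType) (B : set R) : \bar R :=
  \int[lebesgue_measure]_(x in B) (expR (- x))%:E.

(* The maximum over the infinitely many points, taken as a supremum so that it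
   is defined at every w. *)
Definition zeta (R : realType) (dO : measure_display) (Om : measurableType dO)
    (T : Type) (P : nat -> Om -> R) (Zs : nat -> process R Om T)
    (t : T) (w : Om) : \bar R :=
  ereal_sup (range (fun i => (P i w)%:E + Zs i t w)).

Definition joint_df (R : realType) (dO : measure_display)
    (Om : measurableType dO) (Pr : probability Om R) (n : nat)
    (X : 'I_n -> Om -> \bar R) (x : 'I_n -> R) : \bar R :=
  Pr [set w | forall i, X i w <= (x i)%:E].

(* enum 'I_n is increasing, so find returns the smallest maximizing index. *)
Definition inf_argmax (R : realType) (n : nat) (a : 'I_n -> \bar R) : nat :=
  find (fun i => [forall j, a j <= a i]) (enum 'I_n).

Lemma inf_argmaxP (R : realType) (n : nat) (a : 'I_n -> \bar R) (k : 'I_n) :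
  inf_argmax a = k <->
  (forall j, a j <= a k) /\
  (forall i : 'I_n, (forall j, a j <= a i) -> (k <= i)%N).
Proof.
pose p := fun i => [forall j, a j <= a i].
split=> [E|[Hk Hmin]].
- have hasp : has p (enum 'I_n).
    by rewrite has_find -/(inf_argmax a) E size_enum_ord.
  split=> [j|i Hi].
    have := nth_find k hasp.
    by rewrite -/(inf_argmax a) E nth_ord_enum => /forallP/(_ j).
  rewrite leqNgt; apply/negP => ltik.
  have := @before_find _ k p (enum 'I_n) i.
  by rewrite -/(inf_argmax a) E nth_ord_enum => /(_ ltik)/forallP; apply.
- have hasp : has p (enum 'I_n).
    by apply/hasP; exists k; rewrite ?mem_enum//; apply/forallP.
  have lt : (inf_argmax a < n)%N by move: hasp; rewrite has_find size_enum_ord.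
  have := nth_find k hasp; rewrite -/(inf_argmax a).
  rewrite (_ : nth k _ _ = Ordinal lt); last first.
    by rewrite -[inf_argmax a]/(val (Ordinal lt)) nth_ord_enum.
  move=> /forallP /Hmin /= lek; apply/eqP; rewrite eqn_leq lek andbT leqNgt.
  apply/negP => gt.
  have := @before_find _ k p (enum 'I_n) k gt.
  by rewrite nth_ord_enum => /forallP; apply.
Qed.

(* Main.v *)
From HB Require Import structures.
Require Import Defs.
From mathcomp Require Import all_boot all_order all_algebra finmap.
From mathcomp Require Import ring lra.
From mathcomp Require Import all_classical all_reals all_analysis.

(** The maximum zeta stays below x at the times t_k exactly when every point P_i
    with its mark Z_i satisfies P_i + Z_i(t_k) <= x_k for all k. The marks are
    independent of the points, so the points can be frozen
    ([probability_freezing]); as the marks are independent copies of Z, this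
    leaves the infinite product of the 1 - u(P_i), where u(p) is the probability
    that p + Z(t_k) > x_k for some k ([prob_all_points_below]).

    The mean of such a product over a Poisson process is the exponential of
    minus the integral of u against the intensity ([poisson_infinite_prod]).
    For u a step function this says that the numbers of points in disjoint sets
    are independent and that a Poisson variable N of mean l satisfies
    E (1-c)^N = e^(-cl); increasing simple functions give the general case.
    Hence -ln H(x) is the integral of u(p) e^-p dp.

    By Tonelli that integral is the mean of max_k e^(Z(t_k) - x_k)
    ([exponent_measure]): for fixed Z the exceeding points p form the half-line
    beyond the opposite of the largest Z(t_k) - x_k. Splitting along the first
    index k that realises the maximum gives the sum of the
    e^-x_k E(e^Z(t_k); k is the first maximiser).

    Finally, conditioning on Z(h) > -oo and then tilting by e^V(h) is the same
    as tilting Z by e^Z(h), since E e^Z(h) = 1 and e^Z(h) vanishes where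
    Z(h) = -oo ([tilted_law_formula]). Under the law tilted at t_k, subtracting
    the finite number Z(t_k) from all coordinates does not move the first
    maximiser, so the k-th expectation is Psi_k(x). *)

Set Implicit Arguments.
Unset Strict Implicit.
Unset Printing Implicit Defensive.

Import Order.TTheory GRing.Theory Num.Theory.
Import numFieldNormedType.Exports.

Local Open Scope classical_set_scope.
Local Open Scope ring_scope.
Local Open Scope ereal_scope.

(** * Path space and tilted laws *)

Definition cylinders (R : realType) (T : Type) : set_system (T -> \bar R) :=
  [set A | exists t, exists2 B, measurable B & A = (fun f => f t) @^-1` B].

(** The paths with their evaluation sigma-algebra, as a measurable type: its
    measurable sets are by conversion those of [eval_sigma], so that laws of
    processes become image measures. *)
Definition path_space (R : realType) (T : Type) :=
  g_sigma_algebraType (@cylinders R T).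

Section PathSpace.
Variables (R : realType) (T : Type).

Lemma measurable_eval (t : T) :
  measurable_fun setT (fun f : path_space R T => f t).
Proof.
move=> _ B mB; rewrite setTI; apply: sub_sigma_algebra.
by exists t, B.
Qed.

(** [S] is not assumed to be inhabited, so [sigma_gen X] does not make it a
    measurable type, and preimages are treated by induction on the generated
    sigma-algebra instead of as measurable functions. *)
Lemma sigma_gen_path (S I : Type) (d : measure_display) (E : measurableType d)
    (X : I -> S -> E) (Y : T -> S -> \bar R) :
  (forall t B, measurable B -> sigma_gen X (Y t @^-1` B)) ->
  forall A : set (path_space R T), measurable A ->
  sigma_gen X [set w | A (fun t => Y t w)].
Proof.
move=> XY A mA.
pose C := [set B : set (T -> \bar R) | sigma_gen X [set w | B (fun t => Y t w)]].
have : C A; last by [].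
apply: (smallest_sub _ _ mA) => [|_ [t [B mB ->]]]; last exact: XY.
split=> [|B CB|F CF].
- exact: sigma_algebra0.
- exact: (sigma_algebraCD CB).
- exact: (@sigma_algebra_bigcup _ _ _ (fun i => [set w | F i (fun t => Y t w)]) CF).
Qed.

Lemma measurable_path (d : measure_display) (Om : measurableType d)
    (Y : T -> Om -> \bar R) :
  (forall t, measurable_fun setT (Y t)) ->
  measurable_fun setT (fun w => (fun t => Y t w) : path_space R T).
Proof.
move=> mY.
have := @measurability _ _ Om (path_space R T) setT (fun w => (fun t => Y t w))
  (@cylinders R T) erefl; apply=> _ [_ [t [B mB ->]] <-].
exact: mY.
Qed.

End PathSpace.

Lemma measurable_expeR (R : realType) : measurable_fun setT (@expeR R).
Proof.
have := @measurability _ _ (\bar R) (\bar R) setT (@expeR R) _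
  (ErealGenOInfty.measurableE R); apply=> _ [_ [r ->] <-].
have [r0|r0] := leP 0%R r; last first.
  rewrite [X in measurable X](_ : _ = setT)//; apply/seteqP; split=> // x _.
  by split=> //=; rewrite in_itv/= andbT (lt_le_trans _ (expeR_ge0 _)) ?lte_fin.
have [s sr] := @expeR_total R r%:E r0.
rewrite [X in measurable X](_ : _ = [set` `]s, +oo[]); first exact: emeasurable_itv.
by apply/seteqP; split=> [x []|x] /=; rewrite !in_itv/= !andbT -sr lte_expeR.
Qed.

Section Tilt.
Variables (R : realType) (T : Type) (d1 d2 d3 : measure_display).
Variables (O1 : measurableType d1) (P1 : probability O1 R).
Variables (O2 : measurableType d2) (P2 : probability O2 R).
Variables (O3 : measurableType d3) (P3 : probability O3 R).
Variables (Z : process R O1 T) (V : process R O2 T) (W : process R O3 T) (h : T).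
Hypothesis Z1 : \int[P1]_w expeR (Z h w) = 1.
Hypothesis hV : has_conditional_law P1 P2 h V Z.
Hypothesis hW : has_tilted_law P2 P3 h W V.

Local Notation zpath := (fun w => (fun t => Z t w) : path_space R T).
Local Notation vpath := (fun w => (fun t => V t w) : path_space R T).
Let mz : measurable_fun setT zpath := measurable_path (@path_measurable _ _ _ _ Z).
Let mv : measurable_fun setT vpath := measurable_path (@path_measurable _ _ _ _ V).

Let H : set (path_space R T) := [set f | -oo < f h].
Let mH : measurable H.
Proof.
rewrite -[H]setTI; apply: emeasurable_fun_o_infty => //; exact: measurable_eval.
Qed.

Let p := law P1 Z H.

Let mHz : measurable (zpath @^-1` H).
Proof. by rewrite -[X in measurable X]setTI; exact: mz. Qed.

Let p_fin : p \is a fin_num.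
Proof. exact: fin_num_measure. Qed.

(** A function that vanishes where the path is -oo at [h] is integrated over
    [H] only, and on [H] the law of [Z] is [p] times the law of [V]. *)
Lemma integral_conditional (phi : path_space R T -> \bar R) :
  measurable_fun setT phi -> (forall f, 0 <= phi f) ->
  (forall f, f h = -oo -> phi f = 0) ->
  \int[P1]_w phi (zpath w) = p * \int[P2]_w phi (vpath w).
Proof.
move=> mphi phi0 phiH.
have patchH : phi \_ H = phi.
  apply/funext => f; rewrite patchE; case: ifPn => // /negP fH.
  rewrite phiH//; apply/eqP; rewrite -leeNy_eq leNgt.
  by apply/negP => ?; apply: fH; rewrite inE.
have push d' (O' : measurableType d') (P' : probability O' R)
    (X : O' -> path_space R T) : measurable_fun setT X ->
    \int[P']_w phi (X w) = \int[pushforward P' X]_(f in H) phi f.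
  move=> mX; rewrite [RHS]integral_mkcond patchH ge0_integral_pushforward//.
have p0 : 0 <= p by exact: measure_ge0.
have p00 : (0 <= fine p)%R by exact: fine_ge0.
rewrite (push _ _ P1 zpath)// (push _ _ P2 vpath)// -[p]fineK//.
rewrite -[X in X%:E * _]/((NngNum p00)%:num).
rewrite -ge0_integral_mscale//; last exact: measurable_funTS.
apply: eq_measure_integral => A mA AH /=.
rewrite /mscale /= /pushforward/=.
transitivity (p * law P2 V A); last by rewrite -[in LHS](fineK p_fin).
rewrite hV// setIidl//.
have [p_eq0|pN0] := eqVneq p 0.
  rewrite p_eq0 mul0e; apply/eqP; rewrite -measure_le0 -p_eq0.
  apply: le_measure; rewrite ?inE//.
    by rewrite -[X in measurable X]setTI; exact: mz.
  by move=> w; exact: AH.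
by rewrite muleCA divee ?mule1.
Qed.

(** The tilt normalises by the mean of e^V(h), which is 1/[p]: the density
    e^Z(h) has integral 1 and charges only [H]. This cancels the factor [p] of
    the conditioning, and [W] has density e^Z(h) with respect to [Z] itself. *)
Lemma tilted_law_formula (A : set (path_space R T)) : measurable A ->
  law P3 W A = \int[P1]_w (expeR (Z h w) * (\1_A (zpath w))%:E).
Proof.
move=> mA; rewrite hW//.
have mexp : measurable_fun setT (fun f : path_space R T => expeR (f h)).
  by apply: measurableT_comp (@measurable_eval R T h); exact: measurable_expeR.
set m := \int[P2]_v expeR (V h v).
have pm : p * m = 1.
  rewrite -Z1 (integral_conditional mexp)// => f; first exact: expeR_ge0.
  by move=> ->.
have p0 : 0 <= p by exact: measure_ge0.
have [r [s [pE mE r0 rs]]] :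
    exists r s, [/\ p = r%:E, m = s%:E, (0 < r)%R & (r = s^-1)%R].
  have pE := fineK p_fin; rewrite -pE in p0 pm.
  move: p0; rewrite lee_fin le_eqVlt => /predU1P[r0|r0].
    by move: pm; rewrite -r0 mul0e => /eqP; rewrite eq_sym onee_eq0.
  have : 0 <= m by apply: integral_ge0 => *; exact: expeR_ge0.
  move: pm; case: m => [s| |] // pm _; last first.
    by move: pm; rewrite mulry gtr0_sg// mul1e.
  exists (fine p), s; split=> //.
  move: pm => [] pm; apply: (mulIf (x := s)).
    by apply/eqP => s0; move: pm => /eqP; rewrite s0 mulr0 eq_sym oner_eq0.
  rewrite pm mulVf//.
  by apply/eqP => s0; move: pm => /eqP; rewrite s0 mulr0 eq_sym oner_eq0.
have s0 : (0 < s)%R by rewrite -invr_gt0 -rs.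
have mphi : measurable_fun setT
    (fun f : path_space R T => expeR (f h) * (\1_A f)%:E).
  by apply: emeasurable_funM => //; apply/measurable_EFinP.
rewrite (integral_conditional mphi)//; last 2 first.
- by move=> f; rewrite mule_ge0 ?expeR_ge0 ?lee_fin.
- by move=> f ->; rewrite mul0e.
rewrite pE -ge0_integralZl//; last 3 first.
- by apply: (measurableT_comp mphi); exact: mv.
- by move=> w _; rewrite mule_ge0 ?expeR_ge0 ?lee_fin.
- by rewrite lee_fin ltW.
apply: eq_integral => w _; rewrite muleA mE lne_EFin// expeRD muleC.
rewrite [r%:E * _]muleC muleC; congr (_ * _ * _).
by rewrite -EFinN /= expRN lnK ?posrE// rs.
Qed.

End Tilt.

(** * Independence *)

Section Freezing.
Variables (R : realType) (d d1 d2 : measure_display) (Om : measurableType d).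
Variables (Pr : probability Om R) (T1 : measurableType d1) (T2 : measurableType d2).

(** Independence makes the law of the pair a product measure, so one
    component can be frozen while the probability of the section is taken. *)
Lemma probability_freezing (X : Om -> T1) (Y : Om -> T2) (D : set (T1 * T2)) :
  measurable_fun setT X -> measurable_fun setT Y ->
  (forall A B, measurable A -> measurable B ->
     Pr (X @^-1` A `&` Y @^-1` B) = Pr (X @^-1` A) * Pr (Y @^-1` B)) ->
  measurable D ->
  Pr [set w | D (X w, Y w)] = \int[Pr]_w Pr [set v | D (X w, Y v)].
Proof.
move=> mX mY XY mD.
pose pX : {mfun Om >-> T1} := HB.pack X (isMeasurableFun.Build _ _ _ _ _ mX).
pose pY : {mfun Om >-> T2} := HB.pack Y (isMeasurableFun.Build _ _ _ _ _ mY).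
have mXY : measurable_fun setT (fun w => (X w, Y w)) by exact: measurable_fun_pair.
pose pXY : {mfun Om >-> (T1 * T2)%type} :=
  HB.pack (fun w => (X w, Y w)) (isMeasurableFun.Build _ _ _ _ _ mXY).
transitivity ((distribution Pr pX \x distribution Pr pY) D).
  have joint A B : measurable A -> measurable B ->
      distribution Pr pXY (A `*` B) = distribution Pr pX A * distribution Pr pY B.
    exact: XY.
  by rewrite (product_measure_unique (m' := distribution Pr pXY) joint).
rewrite /product_measure1 ge0_integral_pushforward//.
- apply: eq_integral => w _ /=; rewrite /distribution /pushforward/=.
  by congr (Pr _); apply/seteqP; split=> v /=; rewrite /xsection/= inE.
- exact: measurable_fun_xsection.
Qed.
End Freezing.

Section IndependentProduct.
Variables (R : realType) (d : measure_display) (Om : measurableType d).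
Variable (Pr : probability Om R).

Lemma independent_initial (F : nat -> set_system Om) (C : nat -> set Om) n :
  independent_family Pr F -> (forall j, (j < n)%N -> F j (C j)) ->
  Pr (\bigcap_(j in `I_n) C j) = \prod_(j < n) Pr (C j).
Proof.
move=> indF FC; pose J := [fset j in iota 0 n]%fset.
have inJ j : (j \in J) = (j < n)%N by rewrite !inE mem_iota.
have JF j : j \in J -> F j (C j) by rewrite inJ; exact: FC.
have /= := indF J C JF.
rewrite (perm_big (iota 0 n)); last first.
  by rewrite uniq_perm ?fset_uniq ?iota_uniq// => j; rewrite inJ mem_iota.
rewrite -[n in iota 0 n]subn0 -/(index_iota 0 n) big_mkord => <-.
by congr (Pr _); apply/seteqP; split=> w Cw j /= jn; apply: Cw; rewrite /= inJ in jn *.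
Qed.

(** Functions with countably many values, each level being an event of [F].
    Independence of events passes to these by linearity alone, without any
    monotone class argument. *)
Definition discrete_over (F : set_system Om) (y : Om -> R) := exists a A,
  [/\ forall k : nat, (0 <= a k :> R)%R, forall k, F (A k), forall k, measurable (A k)
    & forall w, (y w)%:E = \sum_(k <oo) (a k)%:E * (\1_(A k) w)%:E].

(** The factors are indicators at first, and are replaced one at a time by
    their expansions over levels: each term of such an expansion is a product
    with one more indicator. *)
Lemma expectation_prod_independent (F : nat -> set_system Om) n (y : nat -> Om -> R) :
  independent_family Pr F ->
  (forall j, measurable_fun setT (y j)) ->
  (forall j w, (0 <= y j w <= 1)%R) ->
  (forall j, discrete_over (F j) (y j)) ->
  \int[Pr]_w (\prod_(j < n) y j w)%:E = \prod_(j < n) \int[Pr]_w (y j w)%:E.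
Proof.
move=> indF my y01 dy.
suff claim r : (r <= n)%N -> forall z : nat -> Om -> R,
    (forall j, measurable_fun setT (z j)) ->
    (forall j w, (0 <= z j w <= 1)%R) ->
    (forall j, (j < r)%N -> discrete_over (F j) (z j)) ->
    (forall j, (r <= j < n)%N ->
       exists C, [/\ F j C, measurable C & z j = \1_C]) ->
    \int[Pr]_w (\prod_(j < n) z j w)%:E = \prod_(j < n) \int[Pr]_w (z j w)%:E.
  by apply: (claim n) => // j; case: (leqP n j).
elim: r => [_ z _ _ _ indic|r IH rn z mz z01 zd indic].
  have /choice[C Cz] : forall j, exists C, (j < n)%N ->
      [/\ F j C, measurable C & z j = \1_C].
    move=> j; have [jn|nj] := ltnP j n; last by exists set0.
    by have [C HC] := indic j jn; exists C.
  have -> : \prod_(j < n) \int[Pr]_w (z j w)%:E = \prod_(j < n) Pr (C j).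
    apply: eq_bigr => j _; have [_ mC ->] := Cz j (ltn_ord j).
    by rewrite integral_indic// setIT.
  rewrite -(independent_initial indF); last by move=> j /Cz[].
  rewrite -[in RHS](setIT (\bigcap_(j in _) _)) -integral_indic//; last first.
    by apply: fin_bigcap_measurable => // j /Cz[].
  apply: eq_integral => w _; congr EFin; rewrite indicE.
  have [wC|wC] := boolP (w \in _).
    apply: big1 => j _; have [_ _ ->] := Cz j (ltn_ord j).
    by move: wC; rewrite inE indicE => wC; rewrite mem_set//; exact: (wC j (ltn_ord j)).
  have /existsNP[j /not_implyP[jn jC]] : ~ (\bigcap_(j in `I_n) C j) w.
    by move: wC; rewrite notin_setE.
  rewrite (bigD1 (Ordinal jn))//=; have [_ _ ->] := Cz j jn.
  by rewrite indicE memNset// mul0r.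
have [a [A [a0 FA mA zE]]] := zd r (ltnSn r).
(* The factor of index r is replaced by the indicator of its k-th level. *)
pose z' k j := if j == r then \1_(A k) else z j.
have z'E k j : (j != r) -> z' k j = z j by rewrite /z' => /negbTE ->.
have mz' k j : measurable_fun setT (z' k j) by rewrite /z'; case: ifP.
have z'01 k j w : (0 <= z' k j w <= 1)%R.
  rewrite /z'; case: ifP => // _; rewrite indicE.
  by case: (_ \in _); rewrite lexx ler01.
have IHk k : \int[Pr]_w (\prod_(j < n) z' k j w)%:E =
    \prod_(j < n) \int[Pr]_w (z' k j w)%:E.
  apply: IH => //; first exact: ltnW.
    by move=> j jr; rewrite z'E ?ltn_eqF//; apply: zd; rewrite ltnS ltnW.
  move=> j /andP[rj jn]; have [->|jr] := eqVneq j r.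
    by exists (A k); rewrite /z' eqxx.
  by rewrite z'E//; apply: indic; rewrite jn ltn_neqAle eq_sym jr rj.
pose o : 'I_n := Ordinal rn.
have neq_o (j : 'I_n) : j != o -> (j : nat) != r by [].
have prod0 (u : nat -> Om -> R) : (forall j w, (0 <= u j w <= 1)%R) ->
    forall (P : pred 'I_n) w, (0 <= \prod_(j < n | P j) u j w)%R.
  by move=> u01 P w; apply: prodr_ge0 => j _; have /andP[] := u01 j w.
have mprod (u : nat -> Om -> R) : (forall j, measurable_fun setT (u j)) ->
    measurable_fun setT (fun w => (\prod_(j < n) u j w)%:E).
  by move=> mu; apply/measurable_EFinP; apply: measurable_prod => j _; exact: mu.
transitivity (\int[Pr]_w \sum_(k <oo) (a k)%:E * (\prod_(j < n) z' k j w)%:E).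
  apply: eq_integral => w _; rewrite (bigD1 o)//= EFinM zE muleC.
  rewrite -nneseriesZl; last by move=> k _; rewrite mule_ge0 ?lee_fin.
  apply: eq_eseriesr => k _; rewrite muleCA; congr (_ * _).
  rewrite muleC -EFinM [in RHS](bigD1 o)//= {1}/z' eqxx; congr (_ * _)%:E.
  by apply: eq_bigr => j jo; rewrite z'E// neq_o.
rewrite integral_nneseries//; last 2 first.
- by move=> k; apply: measurable_funeM; exact: mprod.
- by move=> k w _; rewrite mule_ge0 ?lee_fin ?prod0.
have fin (u : Om -> R) : measurable_fun setT u -> (forall w, (0 <= u w <= 1)%R) ->
    exists2 c : R, (0 <= c)%R & \int[Pr]_w (u w)%:E = c%:E.
  move=> mu u01; have u0 : 0 <= \int[Pr]_w (u w)%:E.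
    by apply: integral_ge0 => w _; have /andP[] := u01 w; rewrite lee_fin.
  exists (fine (\int[Pr]_w (u w)%:E)); first exact: fine_ge0.
  rewrite fineK// ge0_fin_numE//; apply: (@le_lt_trans _ _ (\int[Pr]_w 1)).
    apply: ge0_le_integral => //; last first.
    + by move=> w _; have /andP[] := u01 w; rewrite lee_fin.
    + exact/measurable_EFinP.
    by move=> w _; have /andP[] := u01 w; rewrite lee_fin.
  by rewrite integral_cst// mul1e (le_lt_trans (probability_le1 _ _)) ?ltry.
have /choice[c c_] : forall j, exists c : R, (0 <= c)%R /\ \int[Pr]_w (z j w)%:E = c%:E.
  by move=> j; have [c c0 cE] := fin _ (mz j) (z01 j); exists c.
pose C := (\prod_(j < n | j != o) c j)%R.
have CE : \prod_(j < n | j != o) \int[Pr]_w (z j w)%:E = C%:E.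
  by rewrite /C -prodEFin; apply: eq_bigr => j _; have [] := c_ j.
transitivity (\sum_(k <oo) C%:E * ((a k)%:E * Pr (A k))).
  apply: eq_eseriesr => k _.
  rewrite ge0_integralZl_EFin//; last 2 first.
  - by move=> w _; rewrite lee_fin prod0.
  - exact: mprod.
  rewrite IHk (bigD1 o)//= {1}/z' eqxx integral_indic// setIT muleA muleC.
  congr (_ * _); rewrite -CE; apply: eq_bigr => j jo; apply: eq_integral => w _.
  by rewrite z'E// neq_o.
rewrite nneseriesZl; last by move=> k _; rewrite mule_ge0 ?lee_fin.
rewrite (bigD1 o)//= CE muleC; congr (_ * _).
transitivity (\int[Pr]_w \sum_(k <oo) (a k)%:E * (\1_(A k) w)%:E); last first.
  by apply: eq_integral => w _; rewrite zE.
rewrite integral_nneseries//; last 2 first.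
- by move=> k; apply: measurable_funeM; exact/measurable_EFinP.
- by move=> k w _; rewrite mule_ge0 ?lee_fin.
apply: eq_eseriesr => k _; rewrite ge0_integralZl_EFin//.
- by rewrite integral_indic// setIT.
- exact/measurable_EFinP.
Qed.
End IndependentProduct.

(** * Powers of a Poisson count *)

Section Thinning.
Variable R : realType.
Implicit Types (S : set nat) (c : R).

(** (1 - c)^#S, the probability that no point of [S] survives when each is
    kept with probability c; it is 0 when [S] is infinite. *)
Definition thin c S : R :=
  if `[< finite_set S >] then ((1 - c) ^+ #|` fset_set S|)%R else 0%R.

Lemma thin_fin c S k : @counting _ R S = k%:R%:E -> thin c S = ((1 - c) ^+ k)%R.
Proof.
rewrite /counting /thin; case: asboolP => // _ [] /eqP.
by rewrite eqr_nat => /eqP ->.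
Qed.

Lemma thin_infty c S : (forall k : nat, @counting _ R S <> k%:R%:E) -> thin c S = 0%R.
Proof. by rewrite /counting /thin; case: asboolP => // _ /(_ _ erefl). Qed.

(** The condition 0 < c is what makes the limit 0 for infinite [S]. *)
Lemma cvg_thin c S : (0 < c <= 1)%R ->
  (\prod_(i < m) (1 - c * \1_S i))%R @[m --> \oo] --> thin c S.
Proof.
move=> /andP[c0 c1]; pose v i : R := (1 - c * \1_S i)%R.
have vE i : v i = if i \in S then (1 - c)%R else 1%R.
  by rewrite /v indicE; case: (i \in S); rewrite ?mulr1 ?mulr0 ?subr0.
have v01 i : (0 <= v i <= 1)%R.
  by rewrite vE; case: ifP; rewrite ?lexx ?ler01// subr_ge0 c1 gerBl ltW.
pose p m := (\prod_(i < m) v i)%R.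
have p0 m : (0 <= p m)%R by apply: prodr_ge0 => i _; case/andP: (v01 i).
have pS m : p m.+1 = (p m * v m)%R by rewrite /p big_ord_recr.
rewrite /thin; case: asboolP => [finS|infS].
  have [N SN] : exists N, forall i, S i -> (i < N)%N.
    exists (\max_(i <- fset_set S) i).+1 => i Si; rewrite ltnS.
    by apply: (@leq_bigmax_seq _ _ xpredT id); rewrite // in_fset_set// inE.
  apply: cvg_near_cst; exists N => // m /= Nm; rewrite -/(p m).
  rewrite /p; under eq_bigr do rewrite vE.
  rewrite -(big_mkord xpredT (fun i => if i \in S then (1 - c)%R else 1%R)).
  rewrite -big_mkcond/= -big_filter big_const_seq count_predT.
  rewrite -Monoid.iteropE -/(GRing.exp _ _).
  (* Beyond N every element of S has been counted. *)
  congr (_ ^+ _)%R; apply/perm_size/uniq_perm.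
  - by rewrite filter_uniq// iota_uniq.
  - exact: fset_uniq.
  - move=> i; rewrite mem_filter in_fset_set// mem_index_iota/=.
    have [iS|//] := boolP (i \in S); move: iS; rewrite inE => /SN iN.
    exact: leq_trans iN Nm.
have pK K : exists m, (p m <= (1 - c) ^+ K)%R.
  elim: K => [|K [m pmK]]; first by exists 0%N; rewrite /p big_ord0.
  have [i [Si mi]] : exists i, S i /\ (m <= i)%N.
    apply/not_existsP => Sm; apply: infS; apply: (sub_finite_set _ (finite_II m)).
    move=> i Si /=; rewrite ltnNge; apply/negP => mi; exact: (Sm i).
  have pmono m' : (m <= m')%N -> (p m' <= p m)%R.
    elim: m' => [|m' IH]; first by rewrite leqn0 => /eqP ->.
    rewrite leq_eqVlt => /predU1P[<-//|/IH]; apply: le_trans.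
    by rewrite pS ler_piMr//; case/andP: (v01 m').
  exists i.+1; rewrite pS vE mem_set// exprSr ler_pM// ?subr_ge0//.
  exact: le_trans (pmono i mi) pmK.
apply/cvgrPdist_le => e e0.
have /cvgrPdist_le /(_ e e0) [K _ HK] : ((1 - c) ^+ n)%R @[n --> \oo] --> (0 : R)%R.
  by apply: cvg_expr; rewrite ger0_norm ?subr_ge0// ltrBlDr ltrDl.
have [M pM] := pK K; exists M => // m /= Mm.
have := HK K (leqnn K); rewrite !sub0r !normrN.
rewrite [in X in X -> _]ger0_norm ?exprn_ge0 ?subr_ge0// => cK.
rewrite -/(p m) ger0_norm//; apply: le_trans cK; apply: le_trans pM.
elim: m Mm => [|m' IH]; first by rewrite leqn0 => /eqP ->.
rewrite leq_eqVlt => /predU1P[<-//|/IH]; apply: le_trans.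
by rewrite pS ler_piMr//; case/andP: (v01 m').
Qed.

Lemma thin_ge0_le1 c S : (0 < c <= 1)%R -> (0 <= thin c S <= 1)%R.
Proof.
move=> /andP[c0 c1]; rewrite /thin; case: ifP; rewrite ?lexx ?ler01// => _.
by rewrite exprn_ge0 ?exprn_ile1 ?subr_ge0// gerBl ltW.
Qed.

Lemma thin_series d (Om : measurableType d) (S : Om -> set nat) c w :
  (0 < c <= 1)%R ->
  (thin c (S w))%:E = \sum_(k <oo) ((1 - c) ^+ k)%:E *
     (\1_[set v | @counting _ R (S v) = k%:R%:E] w)%:E.
Proof.
move=> /andP[c0 c1].
have pow0 k : (0 <= (1 - c) ^+ k)%R by rewrite exprn_ge0 ?subr_ge0.
have [[k Sk]|noS] := pselect (exists k : nat, @counting _ R (S w) = k%:R%:E).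
  rewrite (thin_fin c Sk) (@nneseriesD1 _ _ k)//; last first.
    by move=> j _; rewrite mule_ge0 ?lee_fin.
  rewrite eseries0 ?adde0; last first.
    move=> j _ jk; rewrite indicE memNset ?mule0//= => Sj.
    by move: Sj jk; rewrite Sk => -[] /eqP; rewrite eqr_nat eq_sym => ->.
  by rewrite indicE mem_set// mule1.
rewrite thin_infty; last by move=> k Sk; apply: noS; exists k.
rewrite eseries0// => k _ _; rewrite indicE memNset ?mule0// => Sk.
by apply: noS; exists k.
Qed.

(** The generating function of the Poisson distribution of mean l, at 1 - c. *)
Lemma poisson_pgf (l c : R) : (0 <= l)%R -> (0 <= c <= 1)%R ->
  \sum_(k <oo) ((1 - c) ^+ k)%:E * poisson_prob l k [set k] = (expR (- (c * l)))%:E.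
Proof.
move=> l0 /andP[c0 c1].
have pow0 k : (0 <= (1 - c) ^+ k)%R by rewrite exprn_ge0 ?subr_ge0.
move: l0; rewrite le_eqVlt => /predU1P[<-|l0].
  rewrite (@nneseriesD1 _ _ 0%N)//; last by move=> j _; rewrite mule_ge0 ?lee_fin.
  rewrite eseries0 ?adde0; last first.
    move=> j _ j0; rewrite /poisson_prob ltxx diracE memNset ?mule0//=.
    by move=> j0'; move: j0; rewrite -j0' eqxx.
  by rewrite /poisson_prob ltxx diracE mem_set// expr0 mule1 mulr0 oppr0 expR0.
pose x := ((1 - c) * l)%R.
transitivity (\sum_(k <oo) (expR (- l))%:E * (exp_coeff x k)%:E).
  apply: eq_eseriesr => k _; rewrite /poisson_prob l0 esum_set1; last first.
    by rewrite lee_fin poisson_pmf_ge0.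
  rewrite /poisson_pmf l0 -!EFinM; congr EFin.
  rewrite /exp_coeff /= /x exprMn mulrA [RHS]mulrC; congr (_ * _)%R.
  by rewrite mulrA.
have x0 : (0 <= x)%R by rewrite /x mulr_ge0 ?subr_ge0// ltW.
rewrite nneseriesZl; last by move=> k _; rewrite lee_fin divr_ge0 ?exprn_ge0.
rewrite [X in _ * X](_ : _ = (expR x)%:E); last first.
  rewrite /expR -EFin_lim; last exact: is_cvg_series_exp_coeff.
  by apply/congr_lim/funext => m; rewrite /series/= -sumEFin.
by rewrite -EFinM -expRD /x; congr (expR _)%:E; ring.
Qed.

End Thinning.

(** * Infinite products over a Poisson process *)

Section InfiniteProduct.
Variable R : realType.
Implicit Types v : nat -> R.

Definition infinite_prod v : R := limn (fun m => \prod_(i < m) v i)%R.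

Section Factors.
Variable v : nat -> R.
Hypothesis v01 : forall i, (0 <= v i <= 1)%R.

Lemma partial_prod_ge0 m : (0 <= \prod_(i < m) v i)%R.
Proof. by apply: prodr_ge0 => i _; case/andP: (v01 i). Qed.

Lemma partial_prod_nonincreasing : nonincreasing_seq (fun m => \prod_(i < m) v i)%R.
Proof.
apply/nonincreasing_seqP => m; rewrite big_ord_recr/= ler_piMr ?partial_prod_ge0//.
by case/andP: (v01 m).
Qed.

Lemma is_cvg_infinite_prod : cvgn (fun m => \prod_(i < m) v i)%R.
Proof.
apply: nonincreasing_is_cvgn; first exact: partial_prod_nonincreasing.
by exists 0%R => _ [m _ <-]; exact: partial_prod_ge0.
Qed.

Lemma infinite_prod_le m : (infinite_prod v <= \prod_(i < m) v i)%R.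
Proof.
exact: (nonincreasing_cvgn_ge partial_prod_nonincreasing is_cvg_infinite_prod).
Qed.

Lemma infinite_prod_ge0 : (0 <= infinite_prod v)%R.
Proof.
apply: limr_ge; first exact: is_cvg_infinite_prod.
by apply: nearW => m; exact: partial_prod_ge0.
Qed.

Lemma infinite_prod_le1 : (infinite_prod v <= 1)%R.
Proof. by have := infinite_prod_le 0; rewrite big_ord0. Qed.

End Factors.

Lemma le_infinite_prod v v' : (forall i, (0 <= v i <= 1)%R) ->
  (forall i, (0 <= v' i <= 1)%R) -> (forall i, v i <= v' i)%R ->
  (infinite_prod v <= infinite_prod v')%R.
Proof.
move=> v01 v'01 vv'; apply: ler_lim; try exact: is_cvg_infinite_prod.
apply: nearW => m; apply: ler_prod => i _.
by rewrite vv' andbT; case/andP: (v01 i).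
Qed.

(** Approximating the factors from above allows the two limits to be
    interchanged: an infinite product is the infimum of its partial products. *)
Lemma cvg_infinite_prod (w : nat -> nat -> R) v :
  (forall i, (0 <= v i <= 1)%R) -> (forall N i, v i <= w N i <= 1)%R ->
  (forall i, w N i @[N --> \oo] --> v i) ->
  infinite_prod (w N) @[N --> \oo] --> infinite_prod v.
Proof.
move=> v01 vw1 wv.
have w01 N i : (0 <= w N i <= 1)%R.
  have /andP[vw w1] := vw1 N i; rewrite w1 andbT; apply: le_trans vw.
  by case/andP: (v01 i).
apply/cvgrPdist_le => e e0.
have e20 : (0 < e / 2)%R by rewrite divr_gt0.
have /cvgrPdist_le /(_ _ e20) [m _ Hm] := is_cvg_infinite_prod v01.
have {Hm} := Hm m (leqnn m); rewrite -/(infinite_prod v) distrC.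
rewrite ger0_norm ?subr_ge0 ?infinite_prod_le// => pm.
have : (\prod_(i < m) w N i)%R @[N --> \oo] --> (\prod_(i < m) v i)%R.
  by apply: (cvg_big (@mul_continuous R)) => i _; exact: wv.
move=> /cvgrPdist_le /(_ _ e20) [N0 _ HN]; exists N0 => // N /= N0N.
have := HN N N0N; rewrite /= distrC => /(le_trans (ler_norm _)) pN.
have le1 : (infinite_prod v <= infinite_prod (w N))%R.
  by apply: le_infinite_prod => // i; case/andP: (vw1 N i).
have le2 := infinite_prod_le (w01 N) m.
rewrite distrC ger0_norm ?subr_ge0//.
by lra.
Qed.

End InfiniteProduct.

Section PoissonLaplace.
Variables (R : realType) (d : measure_display) (Om : measurableType d).
Variables (Pr : probability Om R) (mu : set R -> \bar R) (P : nat -> Om -> R).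
Hypothesis mP : forall i, measurable_fun setT (P i).
Hypothesis hP : is_poisson_process Pr mu P.

Let hits (B : set R) w : set nat := [set i | B (P i w)].

Let partial_thin (B : set R) (c : R) m w :
  (\prod_(i < m) (1 - c * \1_(hits B w) i))%R =
  (\prod_(i < m) (1 - c * \1_B (P i w)))%R.
Proof. by apply: eq_bigr => i _; rewrite !indicE. Qed.

Let measurable_thin (B : set R) (c : R) : measurable B -> (0 < c <= 1)%R ->
  measurable_fun setT (fun w => thin c (hits B w)).
Proof.
move=> mB c01.
pose h m w := (\prod_(i < m) (1 - c * \1_B (P i w)))%R.
have mh m : measurable_fun setT (h m).
  apply: measurable_prod => i _; apply: measurable_funB; first exact: measurable_cst.
  apply: measurable_funM; first exact: measurable_cst.
  exact: (@measurableT_comp _ _ _ _ _ _ (\1_B : R -> R) _ (P i)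
    (measurable_indic mB) (mP i)).
apply: (measurable_fun_cvg mh).
move=> w _; have := @cvg_thin R c (hits B w) c01.
by under [X in X @ _ --> _ -> _]eq_fun do rewrite partial_thin.
Qed.

(* The count is recovered from 2^-count, a limit of finite products. *)
Let measurable_hits (B : set R) (k : nat) : measurable B ->
  measurable [set w | @counting _ R (hits B w) = k%:R%:E].
Proof.
move=> mB; have h01 : (0 < (2^-1 : R) <= 1)%R by rewrite invr_gt0 ltr0n invf_le1 ?ler1n.
have half : (1 - 2^-1 = 2^-1 :> R)%R by lra.
have half0 : (0 < 2^-1 :> R)%R by rewrite invr_gt0.
rewrite [X in measurable X](_ : _ =
  (fun w => thin (2^-1 : R)%R (hits B w)) @^-1` [set (2^-1 ^+ k : R)%R]).
  by rewrite -[X in measurable X]setTI; apply: measurable_thin.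
apply/seteqP; split=> w /=; first by move=> /thin_fin ->; rewrite half.
rewrite /thin /counting; case: asboolP => _; last first.
  by move=> /esym/eqP; rewrite gt_eqF// exprn_gt0.
by rewrite half => /ieexprIn -> //; rewrite lt_eqF// invf_lt1// ltr1n.
Qed.

Let integral_thin (B : set R) (c l : R) : measurable B -> mu B = l%:E ->
  (0 <= l)%R -> (0 < c <= 1)%R ->
  \int[Pr]_w (thin c (hits B w))%:E = (expR (- (c * l)))%:E.
Proof.
move=> mB muB l0 c01; have /andP[c0 c1] := c01.
rewrite -(poisson_pgf l0); last by rewrite ltW.
have pow0 k : (0 <= (1 - c) ^+ k)%R by rewrite exprn_ge0 ?subr_ge0.
under eq_integral do rewrite (thin_series (hits B) _ c01).
rewrite integral_nneseries//; last 2 first.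
- move=> k; apply: measurable_funeM; apply/measurable_EFinP.
  by apply: measurable_indic; exact: measurable_hits.
- by move=> k w _; rewrite mule_ge0 ?lee_fin.
apply: eq_eseriesr => k _; rewrite ge0_integralZl_EFin//; last first.
  by apply/measurable_EFinP; apply: measurable_indic; exact: measurable_hits.
rewrite integral_indic ?setIT//; last exact: measurable_hits.
have := poisson_count hP mB; rewrite muB => /(_ (ltry _) k) /= <-.
by [].
Qed.

(* At most one of the indicators is not 0, as the sets are disjoint. *)
Let step_prod (r : nat) (B : nat -> set R) (c : nat -> R) x : trivIset [set: nat] B ->
  (1 - \sum_(j < r) c j * \1_(B j) x)%R = (\prod_(j < r) (1 - c j * \1_(B j) x))%R.
Proof.
move=> tB; have [[j Bj]|noj] := pselect (exists j : 'I_r, B j x).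
  have zero (i : 'I_r) : i != j -> (\1_(B i) x = 0 :> R)%R.
    move=> ij; rewrite indicE memNset// => Bi; move/eqP: ij; apply; apply: val_inj.
    by apply: tB => //; exists x.
  rewrite (bigD1 j)//= [in RHS](bigD1 j)//= big1 ?big1 ?addr0 ?mulr1//.
    by move=> i ij; rewrite zero// mulr0 subr0.
  by move=> i ij; rewrite zero// mulr0.
have zero (i : 'I_r) : (\1_(B i) x = 0 :> R)%R.
  by rewrite indicE memNset// => Bi; apply: noj; exists i.
rewrite big1 ?big1 ?subr0// => i _; by rewrite zero mulr0 ?subr0.
Qed.

(** For a step function the product over the points factors over the steps,
    into powers 1 - c to a number of points; these numbers are independent and
    Poisson. *)
Lemma poisson_infinite_prod_step (r : nat) (B : nat -> set R) (c l : nat -> R) :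
  (forall j, measurable (B j)) -> trivIset [set: nat] B ->
  (forall j, (0 < c j <= 1)%R) -> (forall j, (0 <= l j)%R) ->
  (forall j, mu (B j) = (l j)%:E) ->
  \int[Pr]_w (infinite_prod (fun i => 1 - \sum_(j < r) c j * \1_(B j) (P i w))%R)%:E =
  (expR (- \sum_(j < r) c j * l j))%:E.
Proof.
move=> mB tB c01 l0 muB.
transitivity (\int[Pr]_w (\prod_(j < r) thin (c j) (hits (B j) w))%:E).
  apply: eq_integral => w _; congr EFin; apply/cvg_lim => //.
  rewrite [X in X @ _ --> _](_ : _ = fun m : nat =>
      (\prod_(j < r) \prod_(i < m) (1 - c j * \1_(B j) (P i w)))%R); last first.
    apply/funext => m; rewrite exchange_big/=.
    by apply: eq_bigr => i _; exact: step_prod.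
  apply: (cvg_big (@mul_continuous R)) => j _.
  have := @cvg_thin R (c j) (hits (B j) w) (c01 j).
  by under [X in X @ _ --> _ -> _]eq_fun do rewrite partial_thin.
rewrite (expectation_prod_independent r
  (y := fun j w => thin (c j) (hits (B j) w)) (poisson_indep hP mB tB)).
- under eq_bigr do rewrite (integral_thin (mB _) (muB _) (l0 _) (c01 _)).
  rewrite prodEFin; congr EFin.
  by rewrite -expR_sum sumrN.
- by move=> j; exact: measurable_thin.
- by move=> j w; exact: thin_ge0_le1.
- move=> j; exists (fun k => (1 - c j) ^+ k)%R.
  exists (fun k => [set w | @counting _ R (hits (B j) w) = k%:R%:E]); split.
  + by move=> k; have /andP[_ ?] := c01 j; rewrite exprn_ge0 ?subr_ge0.
  + move=> k; apply: sub_sigma_algebra; exists tt, [set k%:R%:E] => //.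
  + by move=> k; exact: measurable_hits.
  + by move=> w; exact: thin_series.
Qed.

End PoissonLaplace.

Section Intensity.
Variables (R : realType) (d : measure_display) (Om : measurableType d).
Variables (Pr : probability Om R) (g : R -> R) (P : nat -> Om -> R).
Hypothesis mg : measurable_fun setT g.
Hypothesis g0 : forall x, (0 <= g x)%R.
Hypothesis mP : forall i, measurable_fun setT (P i).
Local Notation leb := (@lebesgue_measure R).
Hypothesis hP :
  is_poisson_process Pr (fun B => \int[leb]_(x in B) (g x)%:E) P.

Import HBNNSimple.

Let mgE : measurable_fun setT (EFin \o g).
Proof. exact/measurable_EFinP. Qed.

(** Only the nonzero values of [u] are used as steps: these are the level sets
    of finite intensity, on which the count has a Poisson distribution. *)
Lemma poisson_infinite_prod_simple (u : {nnsfun R >-> R}) (L : R) :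
  (forall x, (u x <= 1)%R) ->
  \int[leb]_x (u x * g x)%:E = L%:E ->
  \int[Pr]_w (infinite_prod (fun i => 1 - u (P i w))%R)%:E = (expR (- L))%:E.
Proof.
move=> u1 uL.
have mu : measurable_fun setT u by [].
pose s : seq R := [seq r <- fset_set (range u) | (0 < r)%R].
have us : uniq s by rewrite filter_uniq// fset_uniq.
have sP r : r \in s <-> (0 < r)%R /\ exists x, u x = r.
  rewrite mem_filter in_fset_set//.
  split=> [/andP[r0 /set_mem[x _ ur]]|[r0 [x ur]]]; first by split => //; exists x.
  by rewrite r0 mem_set//; exists x.
(* Past the end of s the steps are empty, of arbitrary height 1. *)
pose B j := if (j < size s)%N then u @^-1` [set s`_j] else set0.
pose c j := if (j < size s)%N then s`_j else 1%R.
have mB j : measurable (B j).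
  by rewrite /B; case: ifP.
have tB : trivIset [set: nat] B.
  move=> i j _ _; rewrite /B; case: ltnP => [is_|_]; last by case=> ? [].
  case: ltnP => [js|_]; last by case=> ? [].
  move=> [x [/= ui uj]]; apply/eqP; rewrite -(nth_uniq 0%R is_ js us) -ui -uj//.
have c01 j : (0 < c j <= 1)%R.
  rewrite /c; case: ltnP => [js|_]; last by rewrite ltr01 lexx.
  by have /sP[-> [x <-]] := mem_nth 0%R js; rewrite u1.
have uE x : u x = (\sum_(j < size s) c j * \1_(B j) x)%R.
  have [u0|u0] := eqVneq (u x) 0%R.
    rewrite big1 ?u0// => j _; rewrite /c /B ltn_ord indicE memNset ?mulr0//=.
    rewrite u0 => s0; have /sP[+ _] := mem_nth 0%R (ltn_ord j).
    by rewrite -s0 ltxx.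
  have xs : u x \in s by apply/sP; split; [rewrite lt0r u0/=|exists x].
  have ks : (index (u x) s < size s)%N by rewrite index_mem.
  rewrite (bigD1 (Ordinal ks))//= big1 ?addr0; last first.
    move=> j jk; rewrite /c /B ltn_ord indicE memNset ?mulr0//= => uj.
    by move/eqP: jk; apply; apply: val_inj; rewrite /= uj index_uniq.
  by rewrite /c /B ks nth_index// indicE mem_set ?mulr1//= nth_index.
have g0E x : 0 <= (g x)%:E by rewrite lee_fin.
have muB0 j : 0 <= \int[leb]_(x in B j) (g x)%:E by apply: integral_ge0.
have ugE : \int[leb]_x (u x * g x)%:E =
    \sum_(j < size s) (c j)%:E * \int[leb]_(x in B j) (g x)%:E.
  transitivity (\int[leb]_x \sum_(j < size s) (c j)%:E * ((g x)%:E * (\1_(B j) x)%:E)).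
    apply: eq_integral => x _; rewrite uE mulr_suml -sumEFin.
    by apply: eq_bigr => j _; rewrite -!EFinM; congr EFin; ring.
  have c0 j : (0 <= c j)%R by case/andP: (c01 j) => /ltW.
  have mgB j : measurable_fun setT (fun x => (g x)%:E * (\1_(B j) x)%:E).
    apply: emeasurable_funM; first exact: mgE.
    by apply/measurable_EFinP; exact: measurable_indic.
  rewrite ge0_integral_sum//; last 2 first.
  - by move=> j; apply: measurable_funeM; exact: mgB.
  - move=> j x _; apply: mule_ge0; first by rewrite lee_fin.
    by apply: mule_ge0; rewrite lee_fin.
  apply: eq_bigr => j _; rewrite ge0_integralZl_EFin//; last 2 first.
  - by move=> x _; apply: mule_ge0; rewrite lee_fin.
  - exact: mgB.
  congr (_ * _); rewrite [RHS]integral_mkcond; apply: eq_integral => x _.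
  rewrite patchE indicE; case: ifP => _; first by rewrite mule1.
  by rewrite mule0.
have fin j : \int[leb]_(x in B j) (g x)%:E \is a fin_num.
  case: (ltnP j (size s)) => [js|sj]; last by rewrite /B ltnNge sj integral_set0.
  rewrite ge0_fin_numE//; have /andP[c0 _] := c01 j.
  have : (c j)%:E * \int[leb]_(x in B j) (g x)%:E <= L%:E.
    rewrite -uL ugE (bigD1 (Ordinal js))//= leeDl// sume_ge0// => i _.
    by rewrite mule_ge0// lee_fin ltW//; case/andP: (c01 i).
  case: (\int[leb]_(x in B j) (g x)%:E) (muB0 j) => [r|/= _|]//; first by rewrite ltry.
  by rewrite gt0_muley ?lte_fin// leye_eq.
pose l j := fine (\int[leb]_(x in B j) (g x)%:E).
have lE j : \int[leb]_(x in B j) (g x)%:E = (l j)%:E by rewrite fineK.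
have l0 j : (0 <= l j)%R by exact: fine_ge0.
have -> : L = (\sum_(j < size s) c j * l j)%R.
  apply/EFin_inj; rewrite -uL ugE -sumEFin; apply: eq_bigr => j _.
  by rewrite lE.
rewrite -(poisson_infinite_prod_step mP hP (size s) mB tB c01 l0 lE).
apply: eq_integral => w _; congr (infinite_prod _)%:E.
by apply/funext => i; rewrite uE.
Qed.

(** The Laplace functional of the process at -ln(1 - u), reached by increasing
    simple functions: the integrals of [u] converge by monotone convergence and
    the expected products by dominated convergence. *)
Lemma poisson_infinite_prod (u : R -> R) (L : R) : measurable_fun setT u ->
  (forall x, (0 <= u x <= 1)%R) ->
  \int[leb]_x (u x * g x)%:E = L%:E ->
  \int[Pr]_w (infinite_prod (fun i => 1 - u (P i w))%R)%:E = (expR (- L))%:E.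
Proof.
move=> mu u01 uL.
have muE : measurable_fun setT (EFin \o u) by exact/measurable_EFinP.
pose u_ := nnsfun_approx measurableT muE.
have u0 x : setT x -> 0 <= (EFin \o u) x.
  by move=> _; rewrite lee_fin; case/andP: (u01 x).
have u_u N x : (u_ N x <= u x)%R.
  by rewrite -lee_fin /u_ nnsfun_approxE; have := le_approx N u0 (I : setT x); apply.
have nd_u x : {homo (fun N => u_ N x) : m n / (m <= n)%N >-> (m <= n)%R}.
  by move=> m n mn; exact/lefP/nd_nnsfun_approx.
have cvg_u x : u_ N x @[N --> \oo] --> u x.
  have := cvg_nnsfun_approx measurableT muE u0 (I : setT x).
  by move=> /fine_cvgP[].
have u_1 N x : (u_ N x <= 1)%R by apply: le_trans (u_u N x) _; case/andP: (u01 x).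
have mug (v : R -> R) : measurable_fun setT v ->
    measurable_fun setT (fun x => (v x * g x)%:E).
  by move=> mv; apply/measurable_EFinP; exact: measurable_funM.
have u_0 N x : (0 <= u_ N x)%R by [].
have uN0 N x : 0 <= (u_ N x * g x)%:E by rewrite lee_fin mulr_ge0.
have fin N : \int[leb]_x (u_ N x * g x)%:E \is a fin_num.
  rewrite ge0_fin_numE; last by apply: integral_ge0.
  apply: (@le_lt_trans _ _ L%:E); last by rewrite ltry.
  rewrite -uL; apply: ge0_le_integral => //.
  - exact: mug.
  - exact: mug.
  - by move=> x _; rewrite lee_fin ler_wpM2r.
pose LN N := fine (\int[leb]_x (u_ N x * g x)%:E).
have LNE N : \int[leb]_x (u_ N x * g x)%:E = (LN N)%:E by rewrite fineK.
have LN_L : LN N @[N --> \oo] --> L.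
  suff : \int[leb]_x (u_ N x * g x)%:E @[N --> \oo] --> L%:E.
    by move=> /fine_cvgP[].
  rewrite -uL.
  have lim_ug x : (u x * g x)%:E = limn (fun N => (u_ N x * g x)%:E).
    apply/esym/cvg_lim => //; apply: cvg_EFin; first exact: nearW.
    by apply: cvgMr_tmp; exact: cvg_u.
  under [X in _ --> X]eq_integral do rewrite lim_ug.
  apply: cvg_monotone_convergence => //.
  - by move=> N; exact: mug.
  - by move=> x _ m n mn; rewrite lee_fin ler_wpM2r//; exact: nd_u.
have v01 (z : R -> R) : (forall x, (0 <= z x <= 1)%R) ->
    forall w i, (0 <= 1 - z (P i w) <= 1)%R.
  by move=> z01 w i; have /andP[? ?] := z01 (P i w); rewrite subr_ge0 gerBl; apply/andP.
have minf (z : R -> R) : measurable_fun setT z -> (forall x, (0 <= z x <= 1)%R) ->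
    measurable_fun setT (fun w => infinite_prod (fun i => 1 - z (P i w))%R).
  move=> mz z01; pose h m w := (\prod_(i < m) (1 - z (P i w)))%R.
  have mh m : measurable_fun setT (h m).
    apply: measurable_prod => i _; apply: measurable_funB; first exact: measurable_cst.
    exact: measurableT_comp.
  apply: (measurable_fun_cvg mh) => w _; apply: is_cvg_infinite_prod; exact: v01.
have cvg1 : \int[Pr]_w (infinite_prod (fun i => 1 - u_ N (P i w))%R)%:E @[N --> \oo] -->
    \int[Pr]_w (infinite_prod (fun i => 1 - u (P i w))%R)%:E.
  apply: (@dominated_cvg _ _ _ _ _ _ _ _ (cst 1)) => //.
  - by move=> N; apply/measurable_EFinP; apply: minf => // x; rewrite u_1 u_0.
  - move=> w _; apply: cvg_EFin; first exact: nearW.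
    apply: cvg_infinite_prod => [i|N i|i]; first exact: v01.
      by apply/andP; split; [exact: lerB|rewrite gerBl].
    by apply: cvgB; [exact: cvg_cst|exact: cvg_u].
  - apply/integrableP; split => //=; rewrite integral_cst// normr1 mul1e.
    by rewrite (le_lt_trans (probability_le1 _ _))// ltry.
  - move=> N w _; rewrite gee0_abs ?lee_fin; last first.
      by apply: infinite_prod_ge0; apply: v01 => x; rewrite u_1 u_0.
    by apply: infinite_prod_le1; apply: v01 => x; rewrite u_1 u_0.
have cvg2 : \int[Pr]_w (infinite_prod (fun i => 1 - u_ N (P i w))%R)%:E @[N --> \oo] -->
    (expR (- L))%:E.
  under eq_fun do rewrite (poisson_infinite_prod_simple (u_1 _) (LNE _)).
  apply: cvg_EFin; first exact: nearW.
  apply: (continuous_cvg _ (@continuous_expR R (- L)%R)).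
  by apply: cvgN.
exact: (cvg_unique _ cvg1 cvg2).
Qed.

End Intensity.

(** * First maximisers and the exponential density *)

Lemma measurable_inf_argmax (R : realType) (T : Type) (n : nat)
    (a : 'I_n -> path_space R T -> \bar R) (k : 'I_n) :
  (forall i, measurable_fun setT (a i)) ->
  measurable [set f : path_space R T | inf_argmax (fun i => a i f) = k].
Proof.
move=> ma.
(* The first maximiser dominates all, and strictly those before it. *)
rewrite [X in measurable X](_ : _ =
  \bigcap_(j in [set: 'I_n]) (setT `&` [set f | a j f <= a k f]) `&`
  \bigcap_(i in [set i : 'I_n | (i < k)%N]) (setT `&` [set f | a i f < a k f])).
  apply: measurableI; apply: fin_bigcap_measurable => // i _.
  - exact: measurable_lee.
  - exact: measurable_lte.
apply/seteqP; split=> f /=.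
  move=> /inf_argmaxP[kmax kmin]; split=> [j _|i /= ik]; split=> //=.
  rewrite lt_neqAle kmax andbT; apply/eqP => aik.
  have : (k <= i)%N by apply: kmin => j; rewrite aik.
  by rewrite leqNgt ik.
move=> [kmax kmin]; apply/inf_argmaxP; split=> [j|i imax].
  by have [] := kmax j I.
rewrite leqNgt; apply/negP => ik; have [_ /=] := kmin i ik.
by rewrite ltNge imax.
Qed.

Lemma inf_argmax_ex (R : realType) (n : nat) (a : 'I_n -> \bar R) : (0 < n)%N ->
  exists k : 'I_n, inf_argmax a = k.
Proof.
move=> n0; pose i0 := Ordinal n0.
pose m := [arg max_(i > i0) a i]%O.
have mP j : a j <= a m.
  by rewrite /m; case: arg_maxP => // i _; apply.
pose Q := fun i : nat => [exists k : 'I_n, (k == i :> nat) && [forall j, a j <= a k]].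
have exQ : exists i, Q i.
  by exists m; apply/existsP; exists m; rewrite eqxx; apply/forallP.
have [i Qi imin] := ex_minnP exQ.
have /existsP[k /andP[/eqP ki /forallP kmax]] := Qi.
exists k; apply/inf_argmaxP; split=> // k' k'max.
rewrite ki; apply: imin; apply/existsP; exists k'; rewrite eqxx.
exact/forallP.
Qed.

Lemma integral_expRN (R : realType) (a : R) :
  \int[@lebesgue_measure R]_(p in `]a, +oo[) (expR (- p))%:E = (expR (- a))%:E.
Proof.
have mN : measurable_fun setT (fun p : R => expR (- p)).
  by apply: measurableT_comp => //; exact: measurable_oppr.
have cN : continuous (fun p : R => expR (- p)).
  by move=> p; apply: continuous_comp; [exact: opp_continuous|exact: continuous_expR].
rewrite integral_itv_obnd_cbnd; last by apply/measurable_EFinP; exact: measurable_funTS.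
rewrite (@ge0_continuous_FTC2y _ _ (fun p => - expR (- p))%R _ 0%R)//.
- by rewrite EFinN oppeK add0e.
- exact: continuous_subspaceT.
- by rewrite -oppr0; apply: cvgN; exact: cvgr_expR.
- by apply: cvgN; apply/cvg_at_right_filter; exact: cN.
- move=> p _; rewrite derive1E.
  rewrite deriveN// -derive1E derive1_comp// derive1N// derive1_id derive1E.
  by have /funeqP -> := @derive_expR R; rewrite mulrN1 opprK.
Qed.

(** * The exponent measure *)

Section ExponentMeasure.
Variables (R : realType) (T : Type) (dZ : measure_display).
Variables (OZ : measurableType dZ) (PZ : probability OZ R) (Z : process R OZ T).
Variables (n : nat) (t : 'I_n -> T) (x : 'I_n -> R).
Hypothesis n0 : (0 < n)%N.
Local Notation leb := (@lebesgue_measure R).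
Local Notation zpath := (fun w => (fun t => Z t w) : path_space R T).

(** A mark [f] attached to the point [p] respects every level; [p] ranges over
    extended reals so that coordinates of a path can be used as points. *)
Definition stays_below (p : \bar R) : set (path_space R T) :=
  [set f | forall k, p + f (t k) <= (x k)%:E].

Lemma measurable_stays_below (d : measure_display) (S : measurableType d)
    (p : S -> \bar R) (f : S -> path_space R T) :
  measurable_fun setT p -> (forall k, measurable_fun setT (fun s => f s (t k))) ->
  measurable [set s | stays_below (p s) (f s)].
Proof.
move=> mp mf.
rewrite [X in measurable X](_ : _ = \bigcap_(k in [set: 'I_n])
    (setT `&` [set s | p s + f s (t k) <= (x k)%:E])).
  apply: fin_bigcap_measurable => // k _.
  apply: emeasurable_fun_infty_c => //.
  by apply: emeasurable_funD.
apply/seteqP; split=> s /=; first by move=> H k _; split => //; exact: H.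
by move=> H k; have [] := H k I.
Qed.

Definition exceedance (p : R) : R := fine (PZ [set z | ~ stays_below p%:E (zpath z)]).

Let mz k : measurable_fun setT (fun z => Z (t k) z).
Proof. exact: path_measurable. Qed.

Let measurable_below : measurable [set pz : R * OZ | stays_below pz.1%:E (zpath pz.2)].
Proof.
apply: measurable_stays_below.
  by apply/measurable_EFinP; exact: measurable_fst.
by move=> k; apply: (measurableT_comp (mz k)); exact: measurable_snd.
Qed.

Let above : set (R * OZ) := [set pz | ~ stays_below pz.1%:E (zpath pz.2)].

Let mabove : measurable above.
Proof. exact: measurableC measurable_below. Qed.

Let aboveE p : PZ (xsection above p) = (exceedance p)%:E.
Proof.
rewrite /exceedance -(_ : xsection above p = [set z | ~ stays_below p%:E (zpath z)]).
  by rewrite fineK// fin_num_measure//; exact: measurable_xsection.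
by apply/seteqP; split=> z; rewrite /xsection/= inE.
Qed.

Lemma exceedance_ge0_le1 p : (0 <= exceedance p <= 1)%R.
Proof.
rewrite -!lee_fin -aboveE measure_ge0/=; apply: probability_le1.
exact: measurable_xsection.
Qed.

Lemma measurable_exceedance : measurable_fun setT exceedance.
Proof.
apply/measurable_EFinP.
rewrite (_ : EFin \o exceedance = PZ \o xsection above); last first.
  by apply/funext => p /=; rewrite aboveE.
exact: measurable_fun_xsection.
Qed.

Lemma exceedanceC p : PZ [set z | stays_below p%:E (zpath z)] = (1 - exceedance p)%:E.
Proof.
have mB : measurable [set z | stays_below p%:E (zpath z)].
  by apply: measurable_stays_below => //.
have := probability_setC PZ mB; rewrite EFinB => E.
rewrite /exceedance fineK ?fin_num_measure//; last exact: measurableC.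
rewrite (_ : [set z | ~ _] = ~` [set z | stays_below p%:E (zpath z)])// E.
by rewrite oppeB ?fin_num_adde_defr// addeA subee// add0e.
Qed.

(** The set of exceeding points is a half-line starting at the opposite of the
    largest a_i - x_i, and the density e^-p gives the half-line beyond m the
    mass e^-m. *)
Lemma integral_above (a : 'I_n -> \bar R) (k : 'I_n) : (forall i, a i < +oo) ->
  inf_argmax (fun i => a i - (x i)%:E) = k ->
  \int[leb]_p ((expR (- p))%:E *
    (\1_[set p : R | exists i, ((x i)%:E < p%:E + a i)%E] p)%:E) =
  expeR (a k - (x k)%:E).
Proof.
move=> alty /inf_argmaxP[kmax _].
case ak : (a k) => [r| |]; last 2 first.
- by have := alty k; rewrite ak.
- rewrite integral0_eq// => p _; rewrite indicE memNset ?mule0//=.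
  move=> [i]; have := kmax i; rewrite ak /= leeNy_eq.
  by case: (a i).
rewrite (_ : [set p : R | _] = `](x k - r)%R, +oo[%classic); last first.
  apply/seteqP; split=> p /=; rewrite in_itv/= andbT.
    move=> [i]; have := kmax i; rewrite ak; case: (a i) => [s| |]//=.
      by rewrite -!EFinB -EFinD lee_fin lte_fin; lra.
  by move=> H; exists k; rewrite ak -EFinD lte_fin; lra.
rewrite -EFinB /= -[(r - x k)%R]opprB -integral_expRN [RHS]integral_mkcond.
apply: eq_integral => p _; rewrite patchE indicE.
by case: ifP => _; rewrite ?mule1 ?mule0.
Qed.

Definition argmax_at (k : 'I_n) : set (path_space R T) :=
  [set f | inf_argmax (fun i => f (t i) - (x i)%:E) = k].

(** By Tonelli the integral is the mean of max_k e^(Z(t_k) - x_k), which is then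
    split according to the first index where the maximum is attained. *)
Lemma exponent_measure :
  \int[leb]_p (exceedance p * expR (- p))%:E =
  \sum_(k < n) (expR (- x k))%:E * \int[PZ]_z (expeR (Z (t k) z) *
    (\1_(argmax_at k) (zpath z))%:E).
Proof.
pose A := argmax_at.
have mexpN : measurable_fun setT (fun p : R => expR (- p)).
  by apply: measurableT_comp => //; exact: measurable_oppr.
pose F (pz : R * OZ) : \bar R := (expR (- pz.1))%:E * (\1_above pz)%:E.
have mF : measurable_fun setT F.
  apply: emeasurable_funM; last by apply/measurable_EFinP; exact: measurable_indic.
  by apply/measurable_EFinP; apply: (measurableT_comp mexpN); exact: measurable_fst.
have F0 pz : 0 <= F pz by rewrite mule_ge0 ?lee_fin ?expR_ge0.
transitivity (\int[leb]_p \int[PZ]_z F (p, z)).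
  apply: eq_integral => p _; rewrite /F /=.
  rewrite ge0_integralZl_EFin ?expR_ge0//; last first.
    apply/measurable_EFinP.
    rewrite (_ : (fun z => _) = \1_(xsection above p)); last first.
      by apply/funext => z; rewrite !indicE mem_xsection.
    by apply: measurable_indic; exact: measurable_xsection.
  rewrite mulrC EFinM; congr (_ * _); rewrite -aboveE.
  rewrite -[in LHS](setIT (xsection above p)) -integral_indic//; last first.
    exact: measurable_xsection.
  by apply: eq_integral => z _; rewrite !indicE mem_xsection.
rewrite (@fubini_tonelli _ _ _ _ _ leb PZ F mF F0).
have mA k : measurable (A k).
  apply: measurable_inf_argmax => i; apply: emeasurable_funB => //.
  exact: measurable_eval.
have mexpZ k : measurable_fun setT (fun z => expeR (Z (t k) z)).
  by apply: measurableT_comp => //; exact: measurable_expeR.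
have mAz k : measurable (zpath @^-1` A k).
  rewrite -[X in measurable X]setTI.
  exact: (measurable_path (@path_measurable _ _ _ _ Z) measurableT (mA k)).
have mG k : measurable_fun setT (fun z => expeR (Z (t k) z) * (\1_(A k) (zpath z))%:E).
  apply: emeasurable_funM => //; apply/measurable_EFinP.
  exact: (measurable_indic (mAz k)).
have G0 k z : 0 <= expeR (Z (t k) z) * (\1_(A k) (zpath z))%:E.
  by rewrite mule_ge0 ?expeR_ge0 ?lee_fin.
transitivity (\int[PZ]_z \sum_(k < n) (expR (- x k))%:E *
    (expeR (Z (t k) z) * (\1_(A k) (zpath z))%:E)).
  apply: eq_integral => z _.
  have [k kmax] := inf_argmax_ex (fun i => Z (t i) z - (x i)%:E) n0.
  rewrite (bigD1 k)//= big1 ?adde0; last first.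
    move=> j jk; rewrite indicE memNset ?mule0 ?mule0//= => jmax.
    by move/eqP: jk; apply; apply: val_inj; rewrite /= -kmax.
  rewrite indicE mem_set// mule1 muleC -[X in _ * X]/(expeR (- x k)%:E) -expeRD.
  rewrite EFinN -(integral_above _ kmax); last by move=> i; exact: path_lty.
  apply: eq_integral => p _; rewrite /F/=; congr (_ * _%:E).
  rewrite !indicE; congr (_%:R); congr (nat_of_bool _).
  apply/idP/idP; rewrite !inE /above /stays_below /=.
    by move=> /existsNP[i /negP]; rewrite -ltNge => ?; exists i.
  by move=> [i +] /(_ i); rewrite leNgt => ->.
rewrite ge0_integral_sum//; last 2 first.
- by move=> k; apply: measurable_funeM.
- by move=> k z _; apply: mule_ge0 => //; rewrite lee_fin expR_ge0.
by apply: eq_bigr => k _; rewrite ge0_integralZl_EFin ?expR_ge0.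
Qed.

End ExponentMeasure.

(** * Points marked by independent copies *)

Section MarkedPoisson.
Variables (R : realType) (T : Type) (dZ : measure_display).
Variables (OZ : measurableType dZ) (PZ : probability OZ R) (Z : process R OZ T).
Variables (d : measure_display) (Om : measurableType d) (Pr : probability Om R).
Variables (P : nat -> Om -> R) (Zs : nat -> process R Om T).
Variables (n : nat) (t : 'I_n -> T) (x : 'I_n -> R).
Hypothesis mP : forall i, measurable_fun setT (P i).
Hypothesis hcopy : forall i, same_law PZ Pr (Zs i) Z.
Hypothesis hindep : independent_family Pr (fun i => sigma_gen (Zs i)).
Hypothesis hindepP : independent2 Pr (sigma_gen P)
  (sigma_gen (fun it : nat * T => Zs it.1 it.2)).

Local Notation below := (stays_below t x).
Local Notation zpath i := (fun w => (fun s => Zs i s w) : path_space R T).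
Local Notation u := (exceedance PZ Z t x).

Lemma measurable_below_cst (p : \bar R) : measurable (below p : set (path_space R T)).
Proof.
apply: (@measurable_stays_below _ _ _ t x _ _ (fun=> p) id) => // k.
exact: measurable_eval.
Qed.

Lemma prob_below_copy i (p : R) : Pr [set v | below p%:E (zpath i v)] = (1 - u p)%:E.
Proof.
rewrite -exceedanceC; exact: (hcopy i (measurable_below_cst p%:E)).
Qed.

Lemma prob_all_below (p : nat -> R) :
  Pr [set v | forall i, below (p i)%:E (zpath i v)] =
  (infinite_prod (fun i => 1 - u (p i))%R)%:E.
Proof.
pose E i : set Om := [set v | below (p i)%:E (zpath i v)].
have mE i : measurable (E i).
  by apply: measurable_stays_below => // k; exact: path_measurable.
pose F m := \bigcap_(i in `I_m) E i.
have mF m : measurable (F m) by apply: fin_bigcap_measurable.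
have -> : [set v | forall i, below (p i)%:E (zpath i v)] = \bigcap_m F m.
  apply/seteqP; split=> v; first by move=> H m _ i _; exact: H.
  by move=> H i; exact: (H i.+1 I i (ltnSn i)).
have FE m : Pr (F m) = (\prod_(i < m) (1 - u (p i))%R)%:E.
  rewrite (independent_initial hindep) => [|i _].
    by rewrite -prodEFin; apply: eq_bigr => i _; rewrite prob_below_copy.
  apply: (@sigma_gen_path _ _ _ _ _ _ (Zs i) (Zs i) _ _ (measurable_below_cst _)).
  by move=> s B mB; apply: sub_sigma_algebra; exists s, B.
have cF : Pr \o F @ \oo --> Pr (\bigcap_m F m).
  apply: nonincreasing_cvg_mu => //.
  - by rewrite (le_lt_trans (probability_le1 _ _)) ?ltry.
  - by apply: bigcap_measurable => //; exists 0%N.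
  - move=> m m' mm'; apply/subsetPset => v Fv i /= im; apply: Fv => /=.
    exact: leq_trans im mm'.
have cF' : Pr \o F @ \oo --> (infinite_prod (fun i => 1 - u (p i))%R)%:E.
  rewrite (_ : Pr \o F = fun m => (\prod_(i < m) (1 - u (p i))%R)%:E); last first.
    by apply/funext => m /=; rewrite FE.
  apply: cvg_EFin; first exact: nearW.
  apply: is_cvg_infinite_prod => i.
  have /andP[? ?] := exceedance_ge0_le1 PZ Z t x (p i).
  by rewrite subr_ge0 gerBl; apply/andP.
exact: (cvg_unique _ cF cF').
Qed.

(** The whole sequence of points is frozen at once; the marks then obey
    [prob_all_below] with deterministic points. *)
Lemma prob_all_points_below :
  Pr [set w | forall i, below (P i w)%:E (zpath i w)] =
  \int[Pr]_w (infinite_prod (fun i => 1 - u (P i w))%R)%:E.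
Proof.
pose X w : path_space R nat := fun i => (P i w)%:E.
pose Y w : path_space R (nat * T) := fun it => Zs it.1 it.2 w.
have mX : measurable_fun setT X.
  by apply: measurable_path => i; exact/measurable_EFinP.
have mY : measurable_fun setT Y by apply: measurable_path => it; exact: path_measurable.
pose D : set (path_space R nat * path_space R (nat * T)) :=
  [set ab | forall i, below (ab.1 i) (fun s => ab.2 (i, s))].
have mD : measurable D.
  rewrite [D](_ : _ = \bigcap_i [set ab : path_space R nat * path_space R (nat * T) |
      below (ab.1 i) (fun s => ab.2 (i, s))]).
    apply: bigcap_measurable => [|i _]; first by exists 0%N.
    apply: (@measurable_stays_below R T n t x _ _
      (fun ab : path_space R nat * path_space R (nat * T) => ab.1 i)
      (fun ab => (fun s => ab.2 (i, s)) : path_space R T)).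
      by apply: (measurableT_comp (@measurable_eval R nat i)); exact: measurable_fst.
    move=> k; apply: (measurableT_comp (@measurable_eval R (nat * T) (i, t k))).
    exact: measurable_snd.
  by apply/seteqP; split=> ab; [move=> H i _; exact: H|move=> H i; exact: H].
have XY A B : measurable A -> measurable B ->
    Pr (X @^-1` A `&` Y @^-1` B) = Pr (X @^-1` A) * Pr (Y @^-1` B).
  move=> mA mB; apply: hindepP.
    apply: (sigma_gen_path (X := P) (Y := fun i w => (P i w)%:E)) mA => i C mC.
    apply: sub_sigma_algebra; exists i, (EFin @^-1` C) => //.
    by rewrite -[X in measurable X]setTI; exact: EFin_measurable.
  apply: sigma_gen_path mB => it C mC.
  by apply: sub_sigma_algebra; exists it, C.
rewrite (probability_freezing mX mY XY mD).
apply: eq_integral => w _; rewrite -prob_all_below//.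
Qed.

End MarkedPoisson.

Lemma inf_argmax_addr (R : realType) (n : nat) (a : 'I_n -> \bar R) (r : R) :
  inf_argmax (fun i => a i + r%:E) = inf_argmax a.
Proof.
by rewrite /inf_argmax; apply: eq_find => i; apply: eq_forallb => j; rewrite leeD2rE.
Qed.

Theorem theorem4p2 (R : realType) (K : index_kind) (d : nat) (hd : (0 < d)%N)
  (dZ : measure_display) (OZ : measurableType dZ) (PZ : probability OZ R)
  (Z : process R OZ (index_set R K d))
  (hZ : forall t, \int[PZ]_w expeR (Z t w) = 1)
  (dO : measure_display) (Om : measurableType dO) (Pr : probability Om R)
  (P : nat -> {RV Pr >-> R}) (Zs : nat -> process R Om (index_set R K d))
  (hP : is_poisson_process Pr (@exp_intensity R) (fun i => P i : Om -> R))
  (hcopy : forall i, same_law PZ Pr (Zs i) Z)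
  (hindep : independent_family Pr (fun i => sigma_gen (Zs i)))
  (hindepP : independent2 Pr
     (sigma_gen (fun i => P i : Om -> R))
     (sigma_gen (fun it : nat * index_set R K d => Zs it.1 it.2)))
  (dV : index_set R K d -> measure_display)
  (OV : forall h, measurableType (dV h)) (PV : forall h, probability (OV h) R)
  (V : forall h, process R (OV h) (index_set R K d))
  (hV : forall h, has_conditional_law PZ (PV h) h (V h) Z)
  (dW : index_set R K d -> measure_display)
  (OW : forall h, measurableType (dW h)) (PW : forall h, probability (OW h) R)
  (W : forall h, process R (OW h) (index_set R K d))
  (hW : forall h, has_tilted_law (PV h) (PW h) h (W h) (V h))
  (n : nat) (hn : (0 < n)%N) (t : 'I_n -> index_set R K d) (ht : injective t)
  (x : 'I_n -> R) :
  - lne (joint_df Pr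
           (fun i => zeta (fun j => P j : Om -> R) Zs (t i)) x) =
  \sum_(k < n) (expR (- x k))%:E *
    PW (t k) [set w | inf_argmax
      (fun i => Theta (W (t k)) (t k) (t i) w - (x i)%:E) = k :> nat].
Proof.
set S := \sum_(k < n) _.
have mexpN : measurable_fun setT (fun p : R => expR (- p)).
  by apply: measurableT_comp => //; exact: measurable_oppr.
pose T := index_set R K d.
pose B k : set (path_space R T) :=
  [set f | inf_argmax (fun i => f (t i) - f (t k) - (x i)%:E) = k].
have mB k : measurable (B k).
  apply: measurable_inf_argmax => i.
  by apply: emeasurable_funB => //; apply: emeasurable_funB; exact: measurable_eval.
pose Psi k := law (PW (t k)) (W (t k)) (B k).
(* Theta is the difference of W at two times, so this is a law of W. *)
have -> : S = \sum_(k < n) (expR (- x k))%:E * Psi k by [].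
have tilt k : Psi k =
    \int[PZ]_z (expeR (Z (t k) z) * (\1_(argmax_at t x k) (fun s => Z s z))%:E).
  rewrite /Psi (tilted_law_formula (hZ (t k)) (hV (t k)) (hW (t k)) (mB k)).
  apply: eq_integral => z _.
  (* B and argmax_at differ by the shift Z(t_k), a real number wherever the
     density is not 0. *)
  case Zk : (Z (t k) z) => [r| |]; last by rewrite !mul0e.
    congr (_ * _%:E); rewrite !indicE; congr (nat_of_bool _)%:R.
    have shift : inf_argmax (fun i => Z (t i) z - Z (t k) z - (x i)%:E) =
        inf_argmax (fun i => Z (t i) z - (x i)%:E).
      rewrite -[RHS](inf_argmax_addr _ (- r)%R) Zk; congr inf_argmax.
      by apply/funext => i; rewrite addeAC EFinN.
    by apply/idP/idP; rewrite !inE /B /argmax_at /= shift.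
  by have := path_lty Z (t k) z; rewrite Zk.
have SE : \int[@lebesgue_measure R]_p (exceedance PZ Z t x p * expR (- p))%:E =
    \sum_(k < n) (expR (- x k))%:E * Psi k.
  by rewrite exponent_measure//; apply: eq_bigr => k _; rewrite tilt.
have [L SL] : exists L : R, \sum_(k < n) (expR (- x k))%:E * Psi k = L%:E.
  have fin_Psi k : Psi k \is a fin_num.
    apply: fin_num_measure; rewrite -[X in measurable X]setTI.
    exact: (measurable_path (@path_measurable _ _ _ _ (W (t k))) measurableT (mB k)).
  exists (\sum_(k < n) expR (- x k) * fine (Psi k))%R.
  by rewrite -sumEFin; apply: eq_bigr => k _; rewrite EFinM fineK.
have -> : joint_df Pr (fun i => zeta (fun j => P j : Om -> R) Zs (t i)) x =
    Pr [set w | forall i, stays_below t x (P i w)%:E (fun s => Zs i s w)].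
  congr (Pr _); apply/seteqP; split=> w /=.
    move=> H i k; apply: le_trans (H k); apply: ereal_sup_ubound.
    by exists i.
  by move=> H k; apply: ge_ereal_sup => _ [i _ <-]; exact: H.
rewrite (prob_all_points_below t x _ hcopy hindep hindepP)//.
rewrite (@poisson_infinite_prod _ _ _ Pr (fun p => expR (- p)) _ mexpN _ _ hP _ L)//.
- by rewrite SL -[(expR _)%:E]/(expeR (- L)%:E) expeRK -EFinN opprK.
- exact: measurable_exceedance.
- by move=> p; exact: exceedance_ge0_le1.
- by rewrite SE.
Qed.
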